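(* There exist universal constants $C_1,C_2>0$ such that for every $n\ge1$, all $\mathbf{u},\mathbf{v}\in\mathbb{S}^{n-1}$, $\mathcal{G}\sim\mathsf{GOTE}(4,n)$, and any $\varepsilon\in(0,1)$, $$\big|\mathbb{E}\lambda_1(n^{-1/2}\mathcal{G}\cdot\mathbf{u}\otimes\mathbf{v})-\mathbb{E}\lambda_1(n^{-1/2}\mathcal{G}\cdot\mathbf{u}\otimes\mathbf{u})\big|\le C_1\varepsilon+C_2\sqrt{\|\mathbf{u}-\mathbf{v}\|_2\log\big(\tfrac1\varepsilon\big)}.$$
   Context: $\mathcal{G}\sim\mathsf{GOTE}(4,n)$ means that $\mathcal{G}=(\mathcal{G}_{i_1i_2i_3i_4})$ is a random symmetric tensor of order $4$ and dimension $n$ (invariant under permutations of indices in $[n]$) with density proportional to $\exp\big(-\frac18\|\mathcal{G}\|_F^2\big)$, $\|\mathcal{G}\|_F^2=\sum_{i_1,\dots,i_4\in[n]}\mathcal{G}_{i_1i_2i_3i_4}^2$, with respect to Lebesgue measure on the space of symmetric tensors. Equivalently, entries indexed by distinct multisets are independent and $\mathcal{G}_{i_1i_2i_3i_4}\sim\mathcal{N}(0,4/\#\mathrm{Perm}(i_1,\dots,i_4))$, where $\#\mathrm{Perm}$ is the number of distinct rearrangements. $\mathbb{S}^{n-1}$ is the unit sphere of $\mathbb{R}^n$. $\mathcal{G}\cdot\mathbf{u}\otimes\mathbf{v}$ is the $n\times n$ symmetric matrix with $(i,j)$ entry $\sum_{k,l}\mathcal{G}_{ijkl}u_kv_l$.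 $\lambda_1(A)$ is the largest eigenvalue of the symmetric matrix $A$. *)

(* Defs.v *)
From mathcomp Require Import all_boot all_order all_algebra.
From mathcomp Require Import all_classical all_reals all_analysis.
Set Implicit Arguments.
Unset Strict Implicit.
Unset Printing Implicit Defensive.
Import Order.TTheory GRing.Theory Num.Theory.
Local Open Scope classical_set_scope.
Local Open Scope ring_scope.

Definition tensor4 (R : Type) (n : nat) := 4.-tuple 'I_n -> R.

(* [`|u|] on matrices is the sup norm, hence this separate Euclidean norm. *)
Definition norm2 (R : realType) (n : nat) (u : 'rV[R]_n) : R :=
  Num.sqrt (\sum_i u 0 i ^+ 2).

Definition unit_sphere (R : realType) (n : nat) : set 'rV[R]_n :=
  [set u | norm2 u = 1].
Arguments unit_sphere : clear implicits.

Definition tensor_contract (R : realType) (n : nat) (G : tensor4 R n)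
    (u v : 'rV[R]_n) : 'M[R]_n :=
  \matrix_(i, j) \sum_k \sum_l G [tuple i; j; k; l] * u 0 k * v 0 l.

(* For a symmetric matrix of size at least 1 the set of eigenvalues is finite
   and nonempty, so this supremum is a maximum. *)
Definition lambda1 (R : realType) (n : nat) (A : 'M[R]_n) : R :=
  sup [set a : R | eigenvalue A a].

(* Product rule for the family indexed by [J]; the rule for a subfamily
   is the case where the other [B i] are [setT]. *)
Definition independent_family d (T : measurableType d) (R : realType)
    (P : probability T R) (I : finType) (J : {set I})
    (X : I -> {RV P >-> R}) : Prop :=
  forall B : I -> set R, (forall i, measurable (B i)) ->
    P (\bigcap_(i in [set` J]) (X i @^-1` B i)) =
    (\prod_(i in J) P (X i @^-1` B i))%E.

Definition GOTE4 d (T : measurableType d) (R : realType)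
    (P : probability T R) (n : nat)
    (G : 4.-tuple 'I_n -> {RV P >-> R}) : Prop :=
  [/\ forall (i j : 4.-tuple 'I_n) (w : T), perm_eq i j -> G i w = G j w,
      forall (i : 4.-tuple 'I_n) (A : set R), measurable A ->
        distribution P (G i) A =
        normal_prob 0 (Num.sqrt (4 / (size (permutations i))%:R)) A
    & forall J : {set 4.-tuple 'I_n},
        {in J &, forall i j : 4.-tuple 'I_n, perm_eq i j -> i = j} ->
        independent_family J G].

(* Main.v *)
Require Import Defs.
From mathcomp Require Import all_boot all_order all_algebra.
From mathcomp Require Import ring lra zify.
From mathcomp Require Import all_classical all_reals all_analysis measurable_realfun.
Set Implicit Arguments.
Unset Strict Implicit.
Unset Printing Implicit Defensive.
Import Order.TTheory GRing.Theory Num.Theory.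
Local Open Scope classical_set_scope.
Local Open Scope ring_scope.

(** The difference of the two expectations is at most [45 * norm2 (u - v)],
    and since [norm2 (u - v) <= 2] this Lipschitz bound implies the stated one:
    for [eps >= 1/2] the term linear in [eps] already exceeds it, and for
    [eps < 1/2] the logarithm is at least [1/2], so that the square root
    exceeds [norm2 (u - v) / 2].

    The Lipschitz bound comes from Weyl's inequality: the two largest
    eigenvalues differ by at most the operator norm of the contraction of [G]
    against [u] and [v - u], by linearity of the contraction in its second
    vector.  It remains to see that for a unit vector [u] and any [v] the
    contraction of [G] against [u] and [v], normalised by [n^(-1/2)], has
    operator norm of expectation [O(norm2 v)].

    - The supremum over the unit ball is replaced by a maximum over a finite
      set.  Rounding each coordinate of [sqrt n *: x] up or down, according to
      the sign of the coefficient in front of it, increases a given linear form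
      and leads to a point of the scaled lattice of squared norm at most [4].
      There are at most [64 ^ n] such points, so a bilinear form on the unit
      ball is dominated, without any loss, by its values at [4096 ^ n] pairs
      ([net_dominates_bform], [card_net]).
    - At each pair the form is a linear form in the entries of [G], with
      coefficients of squared norm at most [16 * norm2 v ^ 2 / n].  Grouping the
      entries by orbits under permutation of the indices makes it a sum of
      independent normal variables, of variance at most [4] times that squared
      norm: the variance [4 / #Perm] is exactly what the Cauchy-Schwarz
      inequality over an orbit of size [#Perm] consumes ([GOTE4_mgf_le]).
    - A maximum of [exp (O(n))] variables whose moment generating function at
      [n / norm2 v] is [exp (O(n))] has expectation [O(norm2 v)]
      ([contract_sup_bound]).

    The identification of [lambda1] with the maximal Rayleigh quotient
    ([lambda1_max]) gives Weyl's inequality, and also the measurability of the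
    largest eigenvalue, which is needed to speak of the expectation of a
    difference. *)

(** * Largest eigenvalue and Rayleigh quotients *)

Section bilinear_form.
Context (R : realType) (n : nat).
Implicit Types (A B : 'M[R]_n) (x y z : 'rV[R]_n).

Definition bform A x y : R := (x *m A *m y^T) 0 0.

Definition dot x y : R := bform 1%:M x y.

Lemma bformE A x y : bform A x y = \sum_i \sum_j x 0 i * A i j * y 0 j.
Proof.
rewrite /bform mxE exchange_big; apply: eq_bigr => j _.
by rewrite !mxE big_distrl.
Qed.

Lemma bform_row A x y : bform A x y = \sum_j (x *m A) 0 j * y 0 j.
Proof. by rewrite /bform mxE; apply: eq_bigr => j _; rewrite [y^T _ _]mxE. Qed.

Lemma bform_col A x y : bform A x y = \sum_i (A *m y^T) i 0 * x 0 i.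
Proof.
by rewrite /bform -mulmxA mxE; apply: eq_bigr => i _; rewrite mulrC.
Qed.

Lemma dotE x y : dot x y = \sum_i x 0 i * y 0 i.
Proof. by rewrite /dot bform_row mulmx1. Qed.

Lemma dotxx x : dot x x = \sum_i x 0 i ^+ 2.
Proof. by rewrite dotE; apply: eq_bigr => i _; rewrite expr2. Qed.

Lemma dotxx_ge0 x : 0 <= dot x x.
Proof. by rewrite dotxx sumr_ge0 // => i _; rewrite sqr_ge0. Qed.

Lemma dotxx_gt0 x : x != 0 -> 0 < dot x x.
Proof.
rewrite lt_neqAle dotxx_ge0 andbT eq_sym; apply: contra => /eqP/esym.
rewrite dotxx => /psumr_eq0P x0; apply/eqP/rowP => i; rewrite mxE.
by apply/eqP; rewrite eq_sym; rewrite -sqrf_eq0 x0 // => j _; rewrite sqr_ge0.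
Qed.

Lemma bformDl A x y z : bform A (x + y) z = bform A x z + bform A y z.
Proof. by rewrite /bform !mulmxDl mxE. Qed.

Lemma bformZl A a x z : bform A (a *: x) z = a * bform A x z.
Proof. by rewrite /bform -!scalemxAl mxE. Qed.

Lemma bformDr A x y z : bform A z (x + y) = bform A z x + bform A z y.
Proof. by rewrite /bform linearD mulmxDr mxE. Qed.

Lemma bformZr A a x z : bform A z (a *: x) = a * bform A z x.
Proof. by rewrite /bform linearZ /= -scalemxAr mxE. Qed.

Lemma bform_addm A B x y : bform (A + B) x y = bform A x y + bform B x y.
Proof. by rewrite /bform mulmxDr mulmxDl mxE. Qed.

Lemma bform_scalem a A x y : bform (a *: A) x y = a * bform A x y.
Proof. by rewrite /bform -scalemxAr -scalemxAl mxE. Qed.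

Lemma bform_subm A B x y : bform (A - B) x y = bform A x y - bform B x y.
Proof. by rewrite bform_addm -scaleN1r bform_scalem mulN1r. Qed.

Lemma bform_sym A x y : A^T = A -> bform A x y = bform A y x.
Proof.
move=> sA; have -> : bform A x y = (x *m A *m y^T)^T 0 0 by rewrite [RHS]mxE.
by rewrite !trmx_mul trmxK sA mulmxA.
Qed.

Lemma bform_bounded A : exists2 K : R, 0 < K & forall x, bform A x x <= K * dot x x.
Proof.
exists (1 + \sum_i \sum_j `|A i j|).
  by rewrite ltr_pwDl // !sumr_ge0 // => i _; rewrite sumr_ge0.
move=> x; rewrite mulrDl mul1r -[leLHS]add0r lerD ?dotxx_ge0 // bformE.
rewrite mulr_suml ler_sum // => i _; rewrite mulr_suml ler_sum // => j _.
have xle k : x 0 k ^+ 2 <= dot x x.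
  by rewrite dotxx (bigD1 k) //= lerDl sumr_ge0 // => l _; rewrite sqr_ge0.
have -> : x 0 i * A i j * x 0 j = A i j * (x 0 i * x 0 j) by ring.
apply: le_trans (ler_norm _) _; rewrite normrM ler_wpM2l // normrM.
have := xle i; have := xle j; rewrite -(real_normK (num_real (x 0 i))).
rewrite -(real_normK (num_real (x 0 j))).
have := sqr_ge0 (`|x 0 i| - `|x 0 j|); nra.
Qed.

Lemma psd_CauchySchwarz B x y : B^T = B -> (forall z, 0 <= bform B z z) ->
  bform B x y ^+ 2 <= bform B x x * bform B y y.
Proof.
move=> sB psd.
have H t : 0 <= bform B x x + 2 * t * bform B x y + t ^+ 2 * bform B y y.
  have := psd (x + t *: y).
  rewrite bformDl !bformDr !(bformZl, bformZr) (bform_sym y x sB).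
  by congr (0 <= _); ring.
have := psd x; have := psd y.
move: (bform B x x) (bform B x y) (bform B y y) H => a b c H c0 a0.
have [c_eq0|c_neq0] := eqVneq c 0.
  have [->|b0] := eqVneq b 0; first by rewrite expr0n mulr_ge0.
  have := H (- (a + 1) / (2 * b)); rewrite c_eq0 mulr0 addr0.
  have -> : a + 2 * (- (a + 1) / (2 * b)) * b = -1 by field.
  by rewrite oppr_ge0 ler10.
have c_gt0 : 0 < c by rewrite lt_neqAle eq_sym c_neq0.
have := H (- b / c).
have -> : a + 2 * (- b / c) * b + (- b / c) ^+ 2 * c = (a * c - b ^+ 2) / c.
  by field.
by rewrite pmulr_lge0 ?invr_gt0 // subr_ge0.
Qed.

(** Cauchy-Schwarz for [B] applied to [x] and [x *m invmx B], where the form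
    takes the value [dot x x]; the other factor is the form of [invmx B] at
    [x], which is bounded by a multiple of [dot x x]. *)
Lemma psd_unit_coercive B : B^T = B -> (forall z, 0 <= bform B z z) ->
  B \in unitmx -> exists2 K : R, 0 < K & forall x, dot x x <= K * bform B x x.
Proof.
move=> sB psd uB; have [K K0 Kle] := bform_bounded (invmx B).
exists K => // x.
have siB : (invmx B)^T = invmx B by rewrite trmx_inv sB.
have := psd_CauchySchwarz x (x *m invmx B) sB psd.
have -> : bform B x (x *m invmx B) = dot x x.
  by rewrite /dot /bform trmx_mul siB !mulmxA mulmxK // mulmx1.
have -> : bform B (x *m invmx B) (x *m invmx B) = bform (invmx B) x x.
  by rewrite /bform trmx_mul siB mulmxKV // mulmxA.
move=> CS; have := Kle x; have := psd x.
have [x0|] := ltrP 0 (dot x x); last first.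
  by move=> /le_trans H px _; apply: H; rewrite mulr_ge0 // ltW.
by move=> px Kx; rewrite -(ler_pM2r x0); nra.
Qed.

End bilinear_form.

Section lambda1_theory.
Context (R : realType) (n : nat).
Implicit Types (A B : 'M[R]_n) (x y z : 'rV[R]_n).

Lemma eigenvalue_rayleigh A a : eigenvalue A a ->
  exists2 x, dot x x = 1 & bform A x x = a.
Proof.
move=> /eigenvalueP [v vA v0].
have d0 := dotxx_gt0 v0; have s0 : Num.sqrt (dot v v) != 0 by rewrite sqrtr_eq0 -ltNge.
have vv : (Num.sqrt (dot v v))^-1 * ((Num.sqrt (dot v v))^-1 * dot v v) = 1.
  by rewrite -[X in _ * (_ * X)]sqr_sqrtr ?ltW // mulrA -expr2 exprVn mulVf // expf_eq0.
exists ((Num.sqrt (dot v v))^-1 *: v).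
  by rewrite /dot bformZl bformZr -/(dot v v).
rewrite bformZl bformZr.
have -> : bform A v v = a * dot v v.
  by rewrite /dot -bform_scalem /bform vA scalemx1 mul_mx_scalar.
by rewrite -[RHS]mulr1 -vv; ring.
Qed.

(** The supremum [l] of the Rayleigh quotient is an eigenvalue without any
    appeal to compactness: [l%:M - A] is positive semidefinite, so if it were
    invertible it would be coercive, and [l] could be decreased.  It bounds
    every eigenvalue because each one is a Rayleigh quotient. *)
Lemma lambda1_max A : (0 < n)%N -> A^T = A ->
  eigenvalue A (lambda1 A) /\ forall x, bform A x x <= lambda1 A * dot x x.
Proof.
move=> n0 sA.
pose S := [set bform A x x | x in [set x | dot x x = 1]].
have [K K0 KA] := bform_bounded A.
have S_sup : has_sup S.
  split.
    pose e := delta_mx 0 (Ordinal n0) : 'rV[R]_n.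
    exists (bform A e e); exists e => //=; rewrite dotxx (bigD1 (Ordinal n0)) //=.
    rewrite mxE !eqxx expr1n big1 ?addr0 // => i /negbTE i0.
    by rewrite mxE i0 andbF expr0n.
  by exists K => _ [x /= x1 <-]; rewrite -[leRHS]mulr1 -x1.
pose l := sup S.
have Sl x : bform A x x <= l * dot x x.
  have [->|x0] := eqVneq x 0.
    by rewrite /dot /bform trmx0 !mulmx0 mxE mulr0.
  have d0 := dotxx_gt0 x0.
  have s0 : Num.sqrt (dot x x) != 0 by rewrite sqrtr_eq0 -ltNge.
  set c := Num.sqrt (dot x x) in s0.
  have cc : c ^+ 2 = dot x x by rewrite sqr_sqrtr // ltW.
  have : bform A (c^-1 *: x) (c^-1 *: x) <= l.
    apply: sup_upper_bound => //; exists (c^-1 *: x) => //=.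
    rewrite /dot bformZl bformZr -/(dot x x) -cc expr2; field.
    exact: s0.
  rewrite bformZl bformZr mulrA -expr2 exprVn cc.
  by rewrite ler_pdivrMl // mulrC.
have el : eigenvalue A l.
  apply: contraT => nel; exfalso.
  have sB : (l%:M - A)^T = l%:M - A by rewrite linearB /= tr_scalar_mx sA.
  have BE x : bform (l%:M - A) x x = l * dot x x - bform A x x.
    by rewrite bform_subm -scalemx1 bform_scalem.
  have psd z : 0 <= bform (l%:M - A) z z by rewrite BE subr_ge0.
  have uB : l%:M - A \in unitmx.
    rewrite -row_free_unit -kermx_eq0; apply: contraNT nel => k0.
    rewrite /eigenvalue /eigenspace; apply: contraNN k0 => /eqP k0.
    rewrite kermx_eq0 -opprB row_free_unit -scaleN1r unitmxZ ?unitrN1 //.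
    by rewrite -row_free_unit -kermx_eq0 k0.
  have [c c0 cB] := psd_unit_coercive sB psd uB.
  have : l <= l - c^-1; last by rewrite lerBrDr gerDl leNgt invr_gt0 c0.
  apply: ge_sup; first by case: S_sup.
  move=> _ [x /= x1 <-]; have := cB x; rewrite BE x1 mulr1.
  by rewrite -ler_pdivrMl // mulr1 => ?; lra.
suff -> : lambda1 A = l by [].
apply/eqP; rewrite eq_le; apply/andP; split.
  apply: ge_sup; first by exists l.
  by move=> a /= /eigenvalue_rayleigh[x x1 <-]; rewrite -[leRHS]mulr1 -x1.
apply: ub_le_sup => //; exists l => a /= /eigenvalue_rayleigh[x x1 <-].
by rewrite -[leRHS]mulr1 -x1.
Qed.

(** One side of Weyl's inequality: test [B] on the top eigenvector of [A]. *)
Lemma lambda1_sub_le A B c : (0 < n)%N -> A^T = A -> B^T = B ->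
  (forall x, dot x x = 1 -> bform (A - B) x x <= c) ->
  lambda1 A - lambda1 B <= c.
Proof.
move=> n0 sA sB cAB; have [/eigenvalue_rayleigh[x x1 xA] _] := lambda1_max n0 sA.
have [_ /(_ x)] := lambda1_max n0 sB; rewrite x1 mulr1 => xB.
apply: le_trans (cAB x x1); rewrite bform_subm xA.
by rewrite lerD2l lerN2.
Qed.

End lambda1_theory.

(** * A lattice net dominating bilinear forms on the unit ball *)

Section lattice_net.
Context (R : realType) (n : nat).

(** The index [2 * n] stands for the integer [0], so that each coordinate ranges
    over the integers between [- 2 n] and [2 n]. *)
Definition grid := {ffun 'I_n -> 'I_(4 * n).+1}.

Definition gcoord (k : grid) (i : 'I_n) : R := (k i)%:R - (2 * n)%:R.

Definition net : {set grid} := [set k | \sum_i gcoord k i ^+ 2 <= (4 * n)%:R].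

Definition gpoint (k : grid) : 'rV[R]_n := (Num.sqrt n%:R)^-1 *: \row_i gcoord k i.

Lemma gpoint_le4 k : k \in net -> dot (gpoint k) (gpoint k) <= 4.
Proof.
rewrite inE => k4; rewrite /dot bformZl bformZr mulrA -expr2 exprVn sqr_sqrtr //.
have -> : bform 1%:M (\row_i gcoord k i) (\row_i gcoord k i)
    = \sum_i gcoord k i ^+ 2.
  by rewrite -/(dot _ _) dotxx; apply: eq_bigr => i _; rewrite mxE.
move: (\sum_i _) k4 => S k4.
have [n0|n0] := posnP n; first by rewrite n0 invr0 mul0r.
by rewrite ler_pdivrMl ?ltr0n // mulrC -natrM.
Qed.

Lemma round_toward (c y : R) : `|y| <= n%:R -> (0 < n)%N ->
  exists j : 'I_(4 * n).+1,
    c * y <= c * (j%:R - (2 * n)%:R) /\ `|j%:R - (2 * n)%:R : R| <= `|y| + 1.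
Proof.
rewrite ler_norml => /andP[yl yr] n0.
have y0 : 0 <= y + (2 * n)%:R.
  by rewrite natrM; have : (0 : R) <= n%:R by []; lra.
have /andP[ml mr] := truncn_itv y0; set m := Num.truncn _ in ml mr.
have n1 : (1 : R) <= n%:R by rewrite ler1n.
have mn : (m < 4 * n)%N.
  by rewrite -(ltr_nat R) natrM; move: ml; rewrite natrM; lra.
rewrite -natr1 in mr.
have ny := ler_norm y; have nNy := ler_norm (- y); rewrite normrN in nNy.
case: (leP 0 c) => c0.
  exists (Ordinal (mn : (m.+1 < (4 * n).+1)%N)); rewrite /= -natr1; split.
    by rewrite ler_wpM2l //; lra.
  by rewrite ler_norml; apply/andP; split; lra.
exists (Ordinal (ltnW mn : (m < (4 * n).+1)%N)) => /=; split.
  by apply: ler_wnM2l; [exact: ltW | lra].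
by rewrite ler_norml; apply/andP; split; lra.
Qed.

(** After scaling by [sqrt n], rounding moves a coordinate by at most [1], and
    [(sqrt n * |x_i| + 1)^2 <= 2 * n * x_i^2 + 2] sums to at most [4 * n]. *)
Lemma net_dominates_linear (c : 'I_n -> R) (x : 'rV[R]_n) : dot x x <= 1 ->
  exists2 k, k \in net & \sum_i c i * x 0 i <= \sum_i c i * gpoint k 0 i.
Proof.
rewrite dotxx => x1.
have [n0|n0] := posnP n.
  have N0 (F : 'I_n -> R) : \sum_i F i = 0.
    by rewrite big1 // => i _; have := ltn_ord i; rewrite [X in (_ < X)%N]n0.
  exists [ffun => ord0]; last by rewrite !N0.
  by rewrite inE N0.
pose s : R := Num.sqrt n%:R.
have s0 : 0 < s by rewrite sqrtr_gt0 ltr0n.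
have ss : s ^+ 2 = n%:R by rewrite sqr_sqrtr.
have n1 : (1 : R) <= n%:R by rewrite ler1n.
have s1 : 1 <= s by rewrite -[leLHS]sqrtr1 ler_wsqrtr.
have xi1 i : `|x 0 i| <= 1.
  rewrite -(@expr_le1 _ 2) // real_normK ?num_real //; apply: le_trans x1.
  by rewrite (bigD1 i) //= lerDl sumr_ge0 // => l _; rewrite sqr_ge0.
have xn i : `|s * x 0 i| <= n%:R.
  rewrite normrM (gtr0_norm s0) -ss.
  by have := xi1 i; have := normr_ge0 (x 0 i); nra.
have /fin_all_exists [k kP] i := round_toward (c i) (xn i) n0.
exists [ffun i => k i].
  rewrite inE; apply: (@le_trans _ _ (\sum_i (2 * (n%:R * x 0 i ^+ 2) + 2))).
    apply: ler_sum => i _; rewrite /gcoord ffunE; have [_] := kP i.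
    rewrite normrM (gtr0_norm s0) -(real_normK (num_real (_ - _))).
    rewrite -(real_normK (num_real (x 0 i))) -ss.
    have := normr_ge0 ((k i)%:R - (2 * n)%:R : R); have := normr_ge0 (x 0 i).
    move: (`|x 0 i|) (`|_ - _|) s0 => a b ? ? b0 ub.
    have := sqr_ge0 (s * a - 1); have : 0 <= s * a by rewrite mulr_ge0 // ltW.
    rewrite -exprMn; move: (s * a) b b0 ub => u b b0 ub u0 u1.
    by have := ler_pM b0 b0 ub ub; rewrite -!expr2; nra.
  rewrite big_split /= sumr_const card_ord -mulr_sumr -mulr_sumr natrM.
  by rewrite -[2 *+ n]mulr_natr; nra.
apply: ler_sum => i _; rewrite !mxE /gcoord ffunE -/s mulrCA.
by rewrite ler_pdivlMl // mulrCA; have [] := kP i.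
Qed.

Lemma net_dominates_bform (M : 'M[R]_n) x y : dot x x <= 1 -> dot y y <= 1 ->
  exists k l, [/\ k \in net, l \in net &
    bform M x y <= bform M (gpoint k) (gpoint l)].
Proof.
move=> x1 y1.
have [k kn xk] := net_dominates_linear (fun i => (M *m y^T) i 0) x1.
have [l ln yl] := net_dominates_linear (fun i => (gpoint k *m M) 0 i) y1.
exists k, l; split => //.
by rewrite bform_col (le_trans xk) // -bform_col bform_row (le_trans yl) // -bform_row.
Qed.

Lemma sum_geometric_half m : \sum_(j < m) (2^-1 : R) ^+ j <= 2.
Proof.
have -> : \sum_(j < m) (2^-1 : R) ^+ j = 2 - 2 * 2^-1 ^+ m.
  elim: m => [|m IH]; first by rewrite big_ord0 expr0; lra.
  by rewrite big_ord_recr IH /= exprS; field.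
by rewrite lerBlDr lerDl mulr_ge0 // exprn_ge0.
Qed.

Lemma sum_two_sided m N : N = (m + m.+1)%N ->
  \sum_(j < N) (2^-1 : R) ^+ `|j - m|%N <= 4.
Proof.
move=> ->.
rewrite big_split_ord /= [leRHS](_ : 4 = 2 + 2); last by ring.
apply: lerD.
  rewrite (reindex_inj rev_ord_inj) /=; apply: le_trans (sum_geometric_half m).
  apply: ler_sum => i _; apply: ler_wiXn2l; rewrite ?invf_le1 ?ler1n //.
  by have := ltn_ord i; lia.
apply: le_trans (sum_geometric_half m.+1); apply: ler_sum => i _.
by apply: ler_wiXn2l; rewrite ?invf_le1 ?ler1n //; lia.
Qed.

(** On the net the absolute values of the coordinates sum to at most [4 * n], so
    each point contributes at least [1] to the sum of
    [2 ^ (4 n) * prod_i 2 ^ (- |k_i|)] over the whole grid; that sum factors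
    over the coordinates. *)
Lemma card_net : (#|net|%:R : R) <= 64 ^+ n.
Proof.
pose d (j : 'I_(4 * n).+1) : nat := `|j - 2 * n|%N.
have dE (k : grid) i : gcoord k i ^+ 2 = (d (k i) ^ 2)%:R.
  rewrite /gcoord /d natrX natr_absz intr_norm real_normK ?num_real //.
  by rewrite rmorphB.
rewrite -sum1_card natr_sum.
apply: (@le_trans _ _ (\sum_(k : grid) 2 ^+ (4 * n) * \prod_i (2^-1 : R) ^+ d (k i))).
  rewrite [leRHS](bigID (mem net)) /= -[leLHS]addr0 lerD //; last first.
    by rewrite sumr_ge0 // => k _; rewrite mulr_ge0 // prodr_ge0.
  apply: ler_sum => k; rewrite inE (eq_bigr _ (fun i _ => dE k i)).
  rewrite -natr_sum ler_nat -expr_sum exprVn => dk.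
  rewrite ler_pdivlMr ?exprn_gt0 // mul1r ler_weXn2l ?ler1n //.
  apply: leq_trans dk; apply: leq_sum => i _.
  by case: (d _) => // e; rewrite expnS leq_pmulr // expn_gt0.
rewrite -mulr_sumr -(bigA_distr_bigA (fun i j => (2^-1 : R) ^+ d j)) /= prodr_const card_ord.
have -> : 64 = 2 ^+ 4 * 4 :> R by ring.
rewrite exprMn -exprM ler_wpM2l // ?exprn_ge0 //; apply: lerXn2r; rewrite ?nnegrE ?sumr_ge0 //.
by apply: sum_two_sided; lia.
Qed.

End lattice_net.

(** * Densities, normal moment generating functions, independence *)

Section density.
Context d d' (T : measurableType d) (T' : measurableType d') (R : realType).
Variables (mu : {measure set T -> \bar R}) (nu : {measure set T' -> \bar R}).
Import HBNNSimple.

(** Covers both an honest density ([X] the identity, [nu] absolutely continuous)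
    and a pushforward weighted by [W]; the agreement on indicators extends to
    [f] by simple functions and monotone convergence. *)
Lemma ge0_integral_density (X : T -> T') (W : T -> R) (f : T' -> R) :
  measurable_fun setT X -> measurable_fun setT W -> measurable_fun setT f ->
  (forall x, 0 <= W x) -> (forall y, 0 <= f y) ->
  (forall A, measurable A -> (\int[mu]_x (\1_A (X x) * W x)%:E = nu A)%E) ->
  (\int[mu]_x (f (X x) * W x)%:E = \int[nu]_y (f y)%:E)%E.
Proof.
move=> mX mW mf W0 f0 XW.
have mfE : measurable_fun setT (EFin \o f) by exact/measurable_EFinP.
have f0E y : (0 <= (EFin \o f) y)%E by rewrite lee_fin.
pose f_ := nnsfun_approx measurableT mfE.
have fcvg y : EFin \o f_^~ y @ \oo --> (f y)%:E by exact: cvg_nnsfun_approx.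
have fnd y m n : (m <= n)%N -> f_ m y <= f_ n y.
  by move=> mn; exact/lefP/nd_nnsfun_approx.
transitivity (limn (fun n => \int[mu]_x (f_ n (X x) * W x)%:E)%E).
  rewrite -monotone_convergence //.
  - apply: eq_integral => x _; apply/esym/cvg_lim => //.
    under eq_fun do rewrite EFinM; rewrite EFinM.
    by apply: cvgeZr => //; exact: fcvg.
  - move=> n; apply/measurable_EFinP; apply: measurable_funM => //.
    exact: measurableT_comp.
  - by move=> n x _; rewrite lee_fin mulr_ge0.
  - by move=> x _ m n mn; rewrite lee_fin ler_wpM2r // fnd.
transitivity (limn (fun n => \int[nu]_y (f_ n y)%:E)%E); last first.
  rewrite -monotone_convergence //.
  - by apply: eq_integral => x _; apply/cvg_lim => //; exact: fcvg.
  - by move=> n; apply/measurable_EFinP.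
  - by move=> n x _; rewrite lee_fin.
  - by move=> x _ m n mn; rewrite lee_fin fnd.
congr (limn _); apply/funext => n.
have m1 (r : R) : measurable_fun setT (fun x => \1_(f_ n @^-1` [set r]) (X x) : R).
  by apply: measurableT_comp => //; exact: measurable_indic.
transitivity (\sum_(r \in range (f_ n))
   \int[mu]_x (r * (\1_(f_ n @^-1` [set r]) (X x) * W x))%:E)%E.
  rewrite -ge0_integral_fsum //.
  - apply: eq_integral => x _; rewrite fsumEFin // fimfunE.
    rewrite !fsbig_finite //= mulr_suml.
    by congr EFin; apply: eq_bigr => r _; rewrite mulrA.
  - move=> r; apply/measurable_EFinP/measurable_funM => //.
    exact: measurable_funM.
  - move=> r x _; rewrite lee_fin mulrA mulr_ge0 //.
    exact: nnfun_muleindic_ge0.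
under [RHS]eq_integral do rewrite fimfunE -fsumEFin//.
rewrite ge0_integral_fsum //; last 2 first.
  - by move=> r; apply/measurable_EFinP/measurable_funM.
  - by move=> r x _; exact: nnfun_muleindic_ge0.
apply: eq_fsbigr => r _.
rewrite integralZl_indic_nnsfun // integral_indic // setIT.
rewrite -XW //.
have [r0|r0] := leP 0 r.
  under eq_integral do rewrite EFinM.
  rewrite ge0_integralZl_EFin //.
  - by move=> x _; rewrite lee_fin mulr_ge0.
  - by apply/measurable_EFinP/measurable_funM.
rewrite preimage_nnfun0 //.
by rewrite !integral0_eq ?mule0 // => x _; rewrite indic0 ?mulr0 mul0r ?mulr0.
Qed.

End density.

Section normal_mgf.
Context d (T : measurableType d) (R : realType) (P : probability T R).

(** Completing the square: [exp (b y)] times the density of [N(0, s^2)] is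
    [exp (b^2 s^2 / 2)] times the density of [N(b s^2, s^2)]. *)
Lemma normal_mgf (X : {RV P >-> R}) (s b : R) : s != 0 ->
  (forall A, measurable A -> distribution P X A = normal_prob 0 s A) ->
  (\int[P]_w (expR (b * X w))%:E = (expR (b ^+ 2 * s ^+ 2 / 2))%:E)%E.
Proof.
move=> s0 XN.
have mexp : measurable_fun [set: R] (fun y : R => expR (b * y)).
  by apply: measurableT_comp => //; exact: measurable_funM.
have mpdf := measurable_normal_pdf 0 s.
rewrite -[LHS](@ge0_integral_distribution _ _ _ _ _ P X (fun y => (expR (b * y))%:E)); last 2 first.
  - by apply/measurable_EFinP.
  - by move=> y; rewrite lee_fin expR_ge0.
have /= <- // := @ge0_integral_density _ _ (measurableTypeR R) _ R
  (@lebesgue_measure R) (distribution P X) idfun (normal_pdf 0 s)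
  (fun y => expR (b * y)); first last.
- move=> A mA; transitivity (normal_prob 0 s A); last exact/esym/XN.
  rewrite /normal_prob [RHS]integral_mkcond; apply: eq_integral => x _.
  by rewrite patchE indicE /=; case: ifP => _; rewrite ?mul1r ?mul0r.
- by move=> y; exact: normal_pdf_ge0.
- exact: measurable_id.
transitivity (\int[@lebesgue_measure R]_x ((expR (b ^+ 2 * s ^+ 2 / 2))%:E * (normal_pdf (b * s ^+ 2) s x)%:E))%E.
  apply: eq_integral => x _; rewrite -EFinM !normal_pdfE // /normal_fun.
  congr EFin; rewrite mulrCA [RHS]mulrCA -!expRD; congr (_ * expR _).
  by field.
rewrite ge0_integralZl_EFin //.
- by rewrite integral_normal_pdf mule1.
- by move=> x _; rewrite lee_fin normal_pdf_ge0.
- by apply/measurable_EFinP; exact: measurable_normal_pdf.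
Qed.

End normal_mgf.

Section independence.
Context d (T : measurableType d) (R : realType) (P : probability T R).
Context (I : finType) (J : {set I}) (X : I -> {RV P >-> R}).
Hypothesis indepX : independent_family J X.

Lemma measurable_preimage_RV (Y : {RV P >-> R}) (A : set R) :
  measurable A -> measurable (Y @^-1` A).
Proof.
by move=> mA; rewrite -[X in measurable X]setTI; apply: measurable_funP.
Qed.

Lemma probability_integral_indic (A : set T) : measurable A ->
  P A = (\int[P]_w (\1_A w)%:E)%E.
Proof. by move=> mA; rewrite integral_indic // setIT. Qed.

Lemma prod_indic (A : I -> set T) w :
  \prod_(i in J) \1_(A i) w = \1_(\bigcap_(i in [set` J]) A i) w :> R.
Proof.
rewrite [RHS]indicE; case: (boolP (w \in _)) => [|].
  move=> /set_mem wA; rewrite big1 // => i iJ.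
  by rewrite indicE mem_set //; exact: wA.
move=> /negP wA; have [i iJ wi] : exists2 i, i \in J & w \notin A i.
  apply: contrapT => H; apply: wA; apply/mem_set => i iJ; apply: contrapT => wi.
  by apply: H; exists i => //; apply/negP => /set_mem.
by rewrite (bigD1 i) //= indicE (negbTE wi) mul0r.
Qed.

(** The product rule for events is the case where every [g i] is an indicator.
    General functions are introduced one index at a time: for fixed other
    factors both sides are integrals of [g i] against measures on the line,
    which agree on indicators by the previous step. *)
Lemma independent_integral_prod (g : I -> R -> R) :
  (forall i, measurable_fun setT (g i)) -> (forall i y, 0 <= g i y) ->
  (forall i, (\int[P]_w (g i (X i w))%:E < +oo)%E) ->
  (\int[P]_w (\prod_(i in J) g i (X i w))%:E
   = \prod_(i in J) \int[P]_w (g i (X i w))%:E)%E.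
Proof.
move=> mg g0 gfin.
(* [s] lists the indices whose factor is allowed not to be an indicator. *)
suff H (s : seq I) (h : I -> R -> R) :
    (forall i, measurable_fun setT (h i)) -> (forall i y, 0 <= h i y) ->
    (forall i, (\int[P]_w (h i (X i w))%:E < +oo)%E) ->
    (forall i, i \notin s -> exists2 B, measurable B & h i = \1_B) ->
    (\int[P]_w (\prod_(i in J) h i (X i w))%:E
     = \prod_(i in J) \int[P]_w (h i (X i w))%:E)%E.
  by apply: (H (enum I)) => // i; rewrite mem_enum.
elim: s h => [|i s IH] h mh h0 hfin hs.
  have /choice[B hB] i : exists B, measurable B /\ h i = \1_B.
    by have [B mB hB] := hs i isT; exists B.
  have mB i : measurable (B i) by have [] := hB i.
  have hE i : h i = \1_(B i) by have [] := hB i.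
  have mX i : measurable (X i @^-1` B i).
    exact: measurable_preimage_RV.
  transitivity (P (\bigcap_(i in [set` J]) (X i @^-1` B i))).
    rewrite probability_integral_indic; last exact: fin_bigcap_measurable.
    apply: eq_integral => w _; rewrite -prod_indic.
    by congr EFin; apply: eq_bigr => i _; rewrite hE !indicE.
  rewrite indepX //; apply: eq_bigr => i _; rewrite hE.
  by rewrite probability_integral_indic //; apply: eq_integral => x _; rewrite !indicE.
pose h' A j := if j == i then \1_A else h j.
have h'N A j : j != i -> h' A j = h j by rewrite /h' => /negbTE ->.
have h'i A : h' A i = \1_A by rewrite /h' eqxx.
have IHA A : measurable A ->
    (\int[P]_w (\prod_(j in J) h' A j (X j w))%:E
     = \prod_(j in J) \int[P]_w (h' A j (X j w))%:E)%E.
  move=> mA; apply: IH => j; have [->|ji] := eqVneq j i; rewrite ?h'i ?h'N //.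
  - rewrite (eq_integral (fun w => (\1_(X i @^-1` A) w)%:E)); last first.
      by move=> w _; rewrite !indicE.
    have mXA := measurable_preimage_RV (X i) mA.
    by rewrite -probability_integral_indic // (le_lt_trans (probability_le1 P mXA)) // ltry.
  - by exists A.
  - by move=> js; apply: hs; rewrite inE negb_or ji.
have [iJ|iJ] := boolP (i \in J); last first.
  have h'E j : j \in J -> h' setT j = h j.
    by have [->|/h'N] := eqVneq j i => //; rewrite (negbTE iJ).
  have := IHA setT measurableT.
  under eq_integral do rewrite (eq_bigr _ (fun j jJ => congr1 (@^~ _) (h'E j jJ))).
  move=> ->; apply: eq_bigr => j jJ.
  by apply: eq_integral => w _; rewrite h'E.
have mhX j : measurable_fun setT (fun w => h j (X j w)) by exact: measurableT_comp.
pose W w := \prod_(j in J | j != i) h j (X j w).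
pose c := (\prod_(j in J | j != i) \int[P]_w (h j (X j w))%:E)%E.
have W0 w : 0 <= W w by rewrite prodr_ge0.
have c0 : (0 <= c)%E.
  by apply: prode_ge0 => j _; apply: integral_ge0 => w _; rewrite lee_fin.
have cfin : c \is a fin_num.
  apply: prode_fin_num => j _; rewrite ge0_fin_numE //.
  by apply: integral_ge0 => w _; rewrite lee_fin.
pose c' : {nonneg R} := NngNum (fine_ge0 c0).
have c'E : c'%:num%:E = c by rewrite /= fineK.
rewrite (bigD1 i) //= -/c.
under eq_integral do rewrite (bigD1 i) //=.
rewrite (@ge0_integral_density _ _ _ _ _ P (mscale c' (distribution P (X i))) (X i) W (h i)) //.
- rewrite ge0_integral_mscale //.
  + rewrite c'E muleC; congr (_ * _)%E.
    rewrite (@ge0_integral_distribution _ _ _ _ _ P (X i) (fun y => (h i y)%:E)) //.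
      exact/measurable_EFinP.
    by move=> y; rewrite lee_fin.
  + exact/measurable_EFinP.
  + by move=> y _; rewrite lee_fin.
- by rewrite /W; under eq_fun do rewrite -big_filter; apply: measurable_prod.
move=> A mA.
transitivity (c'%:num%:E * distribution P (X i) A)%E; last by [].
rewrite c'E.
have := IHA A mA; rewrite (bigD1 i) //= h'i => Ew.
have -> : c = (\prod_(j in J | j != i) \int[P]_w (h' A j (X j w))%:E)%E.
  apply: eq_bigr => j /andP[_ ji].
  by apply: eq_integral => w _; rewrite h'N.
have -> : distribution P (X i) A = (\int[P]_w (\1_A (X i w))%:E)%E.
  rewrite (eq_integral (fun w => (\1_(X i @^-1` A) w)%:E)); last first.
    by move=> w _; rewrite !indicE.
  by rewrite -probability_integral_indic //; exact: measurable_preimage_RV.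
rewrite muleC -Ew; apply: eq_integral => w _; rewrite (bigD1 i) //= h'i.
congr (_ * _)%:E; apply: eq_bigr => j /andP[_ ji]; by rewrite h'N.
Qed.

End independence.

(** * Measurability of the largest eigenvalue *)

Section lambda1_measurable.
Context (R : realType) (n : nat).

Definition ratvec (q : {ffun 'I_n -> rat}) : 'rV[R]_n := \row_i ratr (q i).

(** The form is continuous and rational vectors are dense. *)
Lemma bform_gt0_rational (B : 'M[R]_n) (x : 'rV[R]_n) : 0 < bform B x x ->
  exists q, 0 < bform B (ratvec q) (ratvec q).
Proof.
(* Moving the coordinates of [x] by at most [e <= 1] changes the form by at
   most [e * S]. *)
move=> b0; pose S := \sum_i \sum_j `|B i j| * (`|x 0 i| + `|x 0 j| + 1).
have S0 : 0 <= S.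
  by apply: sumr_ge0 => i _; apply: sumr_ge0 => j _; rewrite mulr_ge0 // !addr_ge0.
have S1 : 0 < S + 1 by rewrite ltr_pwDr.
pose e := Num.min 1 (bform B x x / (S + 1)).
have e0 : 0 < e by rewrite lt_min ltr01 divr_gt0.
have e1 : e <= 1 by rewrite ge_min lexx.
have eS : e * S < bform B x x.
  have : e * (S + 1) <= bform B x x by rewrite -ler_pdivlMr // ge_min lexx orbT.
  by rewrite mulrDr mulr1; lra.
have /fin_all_exists[q qP] i : exists q : rat, `|ratr q - x 0 i| <= e.
  have : x 0 i - e < x 0 i + e by lra.
  move=> /rat_in_itvoo[q]; rewrite in_itv /= => /andP[q1 q2].
  by exists q; rewrite ler_norml; apply/andP; split; lra.
exists [ffun i => q i]; set y := ratvec _.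
have yP i : `|y 0 i - x 0 i| <= e by rewrite mxE ffunE.
have : `|bform B y y - bform B x x| <= e * S.
  rewrite !bformE -sumrB mulr_sumr; apply: le_trans (ler_norm_sum _ _ _) _.
  apply: ler_sum => i _; rewrite -sumrB mulr_sumr.
  apply: le_trans (ler_norm_sum _ _ _) _; apply: ler_sum => j _.
  have -> : y 0 i * B i j * y 0 j - x 0 i * B i j * x 0 j
      = B i j * ((y 0 i - x 0 i) * (y 0 j - x 0 j)
         + (y 0 i - x 0 i) * x 0 j + x 0 i * (y 0 j - x 0 j)) by ring.
  rewrite normrM mulrCA ler_wpM2l //.
  have := yP i; have := yP j.
  move: (y 0 i - _) (y 0 j - _) => a b b_le a_le.
  apply: le_trans (ler_normD _ _) _; rewrite mulrDr mulr1 mulrDr.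
  have h1 : `|x 0 i * b| <= e * `|x 0 i| by rewrite normrM mulrC ler_wpM2r.
  have h2 : `|a * x 0 j| <= e * `|x 0 j| by rewrite normrM ler_wpM2r.
  have h3 : `|a * b| <= e.
    by rewrite normrM -[leRHS]mulr1 ler_pM // (le_trans b_le).
  have := ler_normD (a * b) (a * x 0 j); lra.
by rewrite ler_norml => /andP[+ _]; lra.
Qed.

(** Turns a strict lower bound on the largest eigenvalue into a countable union
    of conditions, each of which is linear in the entries of [A]. *)
Lemma lambda1_gt_rational (A : 'M[R]_n) c : (0 < n)%N -> A^T = A ->
  c < lambda1 A <->
  exists q, c * dot (ratvec q) (ratvec q) < bform A (ratvec q) (ratvec q).
Proof.
move=> n0 sA; have [eA maxA] := lambda1_max n0 sA.
have BE x : bform (A - c%:M) x x = bform A x x - c * dot x x.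
  by rewrite bform_subm -scalemx1 bform_scalem.
split=> [cA|[q cq]].
  have [x x1 xA] := eigenvalue_rayleigh eA.
  have [|q] := @bform_gt0_rational (A - c%:M) x.
    by rewrite BE x1 xA mulr1 subr_gt0.
  by rewrite BE subr_gt0 => cq; exists q.
have := lt_le_trans cq (maxA _); have := dotxx_ge0 (ratvec q).
rewrite le_eqVlt => /predU1P[<-|q0]; first by rewrite !mulr0 ltxx.
by rewrite ltr_pM2r.
Qed.

Lemma measurable_bform d (T : measurableType d) (A : T -> 'M[R]_n) x y :
  (forall i j, measurable_fun setT (fun w => A w i j)) ->
  measurable_fun setT (fun w => bform (A w) x y).
Proof.
move=> mA; under eq_fun do rewrite bformE.
apply: measurable_sum => i; apply: measurable_sum => j.
by do 2!apply: measurable_funM => //.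
Qed.

Lemma measurable_lambda1 d (T : measurableType d) (A : T -> 'M[R]_n) :
  (0 < n)%N -> (forall w, (A w)^T = A w) ->
  (forall i j, measurable_fun setT (fun w => A w i j)) ->
  measurable_fun setT (fun w => lambda1 (A w)).
Proof.
move=> n0 sA mA mT; apply: (measurability _ (RGenOInfty.measurableE R)) => //.
move=> _ [_ [c ->] <-]; rewrite setTI.
rewrite (_ : _ @^-1` _ = \bigcup_q
  [set w | c * dot (ratvec q) (ratvec q) < bform (A w) (ratvec q) (ratvec q)]).
  apply: countable_bigcupT_measurable => [|q]; first exact: countableP.
  rewrite -[X in measurable X]setTI.
  pose y := ratvec q.
  have := measurable_fun_ltr (measurable_cst (c * dot y y)) (measurable_bform y y mA).
  by move=> /(_ measurableT [set true]); apply.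
apply/seteqP; split=> w /=; rewrite in_itv /= andbT.
  by move=> /(lambda1_gt_rational _ n0 (sA w)) [q cq]; exists q.
move=> [q _ /= cq]; apply/(lambda1_gt_rational _ n0 (sA w)); by exists q.
Qed.

End lambda1_measurable.

(** * Linear forms in a Gaussian orthogonal tensor *)

Lemma sqr_sum_le_card (R : realFieldType) (I : finType) (A : {set I}) (a : I -> R) :
  (\sum_(i in A) a i) ^+ 2 <= #|A|%:R * \sum_(i in A) a i ^+ 2.
Proof.
have -> : #|A|%:R * \sum_(i in A) a i ^+ 2
    = \sum_(i in A) \sum_(j in A) (a i ^+ 2 + a j ^+ 2) / 2.
  under [RHS]eq_bigr => i _.
    rewrite -mulr_suml big_split /= sumr_const -[_ *+ #|A|]mulr_natl; over.
  rewrite -mulr_suml big_split /= sumr_const -mulr_sumr -[_ *+ #|A|]mulr_natl.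
  by field.
rewrite expr2 big_distrlr ler_sum // => i _; rewrite ler_sum // => j _ /=.
by have := sqr_ge0 (a i - a j); nra.
Qed.

Section orbit_representative.
Context (n : nat).
Implicit Types s t : 4.-tuple 'I_n.

(** A canonical element of the orbit of [t] under permutation of its entries; it
    selects one entry of the tensor for each multiset of indices. *)
Definition orbit_rep t : 4.-tuple 'I_n :=
  choose (fun s : 4.-tuple 'I_n => perm_eq t s) t.

Lemma perm_orbit_rep t : perm_eq t (orbit_rep t).
Proof. exact: (@chooseP _ (fun s : 4.-tuple 'I_n => perm_eq t s) t (perm_refl t)). Qed.

Lemma orbit_rep_eq s t : (orbit_rep s == orbit_rep t) = perm_eq s t.
Proof.
apply/eqP/idP => [st|st].
  by rewrite (perm_trans (perm_orbit_rep s)) // st perm_sym perm_orbit_rep.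
rewrite /orbit_rep (@eq_choose _ _ (fun x : 4.-tuple 'I_n => perm_eq t x)).
  by apply: choose_id; rewrite // perm_sym.
by move=> x /=; apply/permPl: x.
Qed.

Lemma orbit_rep_idem t : orbit_rep (orbit_rep t) = orbit_rep t.
Proof. by apply/eqP; rewrite orbit_rep_eq perm_sym perm_orbit_rep. Qed.

Lemma card_orbit_le s :
  (#|[set t | orbit_rep t == orbit_rep s]%SET| <= size (permutations (orbit_rep s)))%N.
Proof.
rewrite cardE -(size_map val); apply: uniq_leq_size.
  by rewrite map_inj_uniq ?enum_uniq //; exact: val_inj.
move=> _ /mapP[t + ->]; rewrite mem_enum inE mem_permutations => /eqP <-.
by rewrite perm_orbit_rep.
Qed.

End orbit_representative.

Section tensor_linear_form.
Context d (T : measurableType d) (R : realType) (P : probability T R) (n : nat).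
Context (G : 4.-tuple 'I_n -> {RV P >-> R}).
Hypothesis GG : GOTE4 G.

(** An orbit of size [N] contributes the normal variable of variance [4 / N]
    multiplied by the sum of its [N] coefficients, whose square is at most [N]
    times the sum of their squares; the factors [N] cancel. *)
Lemma GOTE4_mgf_le (a : 4.-tuple 'I_n -> R) :
  (\int[P]_w (expR (\sum_t a t * G t w))%:E <= (expR (2 * \sum_t a t ^+ 2))%:E)%E.
Proof.
case: GG => Gsym Gnormal Gindep.
pose J := [set orbit_rep t | t : 4.-tuple 'I_n].
have repJ t : orbit_rep t \in J by apply: imset_f.
have indJ : independent_family J G.
  apply: Gindep => _ _ /imsetP[s _ ->] /imsetP[t _ ->].
  by rewrite -orbit_rep_eq !orbit_rep_idem => /eqP.
pose b s := \sum_(t | orbit_rep t == s) a t.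
have GE w : \sum_t a t * G t w = \sum_(s in J) b s * G s w.
  rewrite (partition_big (@orbit_rep n) (mem J)) //=; apply: eq_bigr => s sJ.
  rewrite mulr_suml; apply: eq_bigr => t /eqP <-.
  by rewrite (Gsym _ _ w (perm_orbit_rep t)).
have mgf s : (\int[P]_w (expR (b s * G s w))%:E
    = (expR (b s ^+ 2 * Num.sqrt (4 / (size (permutations s))%:R) ^+ 2 / 2))%:E)%E.
  apply: normal_mgf => [|A mA]; last exact: Gnormal.
  rewrite sqrtr_eq0 -ltNge divr_gt0 // ltr0n.
  have : (s : seq _) \in permutations s by rewrite mem_permutations.
  by case: permutations.
under eq_integral do rewrite GE expR_sum.
rewrite (independent_integral_prod indJ (g := fun s y => expR (b s * y))); last 3 first.
- move=> s; apply: measurableT_comp => //; exact: measurable_funM.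
- by move=> s y; exact: expR_ge0.
- by move=> s; rewrite mgf ltry.
under eq_bigr do rewrite mgf.
rewrite prodEFin -expR_sum lee_fin ler_expR mulr_sumr.
rewrite [leRHS](partition_big (@orbit_rep n) (mem J)) //=.
apply: ler_sum => _ /imsetP[s _ ->].
set N := size _; have := card_orbit_le s; rewrite -/N => cN.
have N0 : 0 < N%:R :> R.
  rewrite ltr0n; apply: leq_trans cN; rewrite card_gt0; apply/set0Pn.
  by exists s; rewrite inE.
rewrite sqr_sqrtr ?divr_ge0 // -mulr_sumr.
have := sqr_sum_le_card [set t | orbit_rep t == orbit_rep s]%SET a.
rewrite (eq_bigl (fun t => orbit_rep t == orbit_rep s)); last by move=> t; rewrite inE.
rewrite -/(b _).
rewrite (eq_bigl (fun t => orbit_rep t == orbit_rep s)); last by move=> t; rewrite inE.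
have : 0 <= \sum_(t | orbit_rep t == orbit_rep s) a t ^+ 2.
  by rewrite sumr_ge0 // => t _; rewrite sqr_ge0.
move: (\sum_(t | _) _) => S S0 bS.
have {}bS : b (orbit_rep s) ^+ 2 <= N%:R * S.
  by apply: le_trans bS _; rewrite ler_wpM2r // ler_nat.
have -> : b (orbit_rep s) ^+ 2 * (4 / N%:R) / 2 = 2 * (b (orbit_rep s) ^+ 2 / N%:R).
  by field; rewrite gt_eqF.
by rewrite ler_pM2l // ler_pdivrMr // mulrC.
Qed.

End tensor_linear_form.

Section contraction.
Context (R : realType) (n : nat).

Let ord4_0 : 'I_4 := Ordinal (isT : (0 < 4)%N).
Let ord4_1 : 'I_4 := Ordinal (isT : (1 < 4)%N).
Let ord4_2 : 'I_4 := Ordinal (isT : (2 < 4)%N).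
Let ord4_3 : 'I_4 := Ordinal (isT : (3 < 4)%N).

Lemma sum_tuple4 (F : 4.-tuple 'I_n -> R) :
  \sum_t F t = \sum_i \sum_j \sum_k \sum_l F [tuple i; j; k; l].
Proof.
rewrite !pair_bigA /=.
rewrite (reindex (fun p : 'I_n * 'I_n * 'I_n * 'I_n =>
  [tuple p.1.1.1; p.1.1.2; p.1.2; p.2])) //=.
exists (fun t : 4.-tuple 'I_n => (tnth t ord4_0, tnth t ord4_1, tnth t ord4_2, tnth t ord4_3)).
  by move=> [[[i j] k] l] _.
move=> t _; apply: val_inj.
by case: t => -[|i [|j [|k [|l [|? ?]]]]] //= e; rewrite !(tnth_nth i).
Qed.

(** The entries of the rank one tensor with factors [x], [y], [u], [v]. *)
Definition rank1 (x y u v : 'rV[R]_n) (t : 4.-tuple 'I_n) : R :=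
  x 0 (tnth t ord4_0) * y 0 (tnth t ord4_1) * u 0 (tnth t ord4_2) * v 0 (tnth t ord4_3).

Lemma rank1E x y u v i j k l :
  rank1 x y u v [tuple i; j; k; l] = x 0 i * y 0 j * u 0 k * v 0 l.
Proof. by rewrite /rank1 !(tnth_nth i). Qed.

Lemma bform_contract (G : tensor4 R n) x y u v :
  bform (tensor_contract G u v) x y = \sum_t rank1 x y u v t * G t.
Proof.
rewrite bformE sum_tuple4; apply: eq_bigr => i _; apply: eq_bigr => j _.
rewrite mxE mulr_sumr mulr_suml; apply: eq_bigr => k _.
rewrite mulr_sumr mulr_suml; apply: eq_bigr => l _.
by rewrite rank1E; ring.
Qed.

Lemma sum_rank1_sqr x y u v :
  \sum_t rank1 x y u v t ^+ 2 = dot x x * dot y y * dot u u * dot v v.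
Proof.
rewrite sum_tuple4 !dotxx -!mulrA mulr_suml; apply: eq_bigr => i _.
rewrite mulr_suml mulr_sumr; apply: eq_bigr => j _.
rewrite mulr_suml !mulr_sumr; apply: eq_bigr => k _.
rewrite !mulr_sumr; apply: eq_bigr => l _.
by rewrite rank1E; ring.
Qed.

Lemma tensor_contract_sym (G : tensor4 R n) u v :
  (forall s t : 4.-tuple 'I_n, perm_eq s t -> G s = G t) ->
  (tensor_contract G u v)^T = tensor_contract G u v.
Proof.
move=> sG; apply/matrixP => i j; rewrite !mxE.
apply: eq_bigr => k _; apply: eq_bigr => l _.
rewrite (sG [tuple j; i; k; l] [tuple i; j; k; l]) //=.
by rewrite (perm_catCA [:: j] [:: i]).
Qed.

Lemma tensor_contractBr (G : tensor4 R n) u v w :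
  tensor_contract G u (v - w) = tensor_contract G u v - tensor_contract G u w.
Proof.
apply/matrixP => i j; rewrite !mxE -sumrB; apply: eq_bigr => k _.
by rewrite -sumrB; apply: eq_bigr => l _; rewrite !mxE; ring.
Qed.

End contraction.

(** * Expected operator norm of a contraction *)

Lemma norm2_sqr (R : realType) (n : nat) (u : 'rV[R]_n) : norm2 u ^+ 2 = dot u u.
Proof. by rewrite /norm2 -dotxx sqr_sqrtr // dotxx_ge0. Qed.

Lemma norm2_ge0 (R : realType) (n : nat) (u : 'rV[R]_n) : 0 <= norm2 u.
Proof. exact: sqrtr_ge0. Qed.

Lemma norm2_eq0 (R : realType) (n : nat) (u : 'rV[R]_n) : norm2 u = 0 -> u = 0.
Proof.
move=> u0; apply: contrapT => /eqP /dotxx_gt0.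
by rewrite -norm2_sqr u0 expr0n ltxx.
Qed.

Lemma expectation_sub_le d (T : measurableType d) (R : realType)
    (P : probability T R) (X Y D : T -> R) :
  P.-integrable setT (EFin \o X) -> P.-integrable setT (EFin \o Y) ->
  measurable_fun setT D -> (forall w, `|X w - Y w| <= D w) ->
  (`|'E_P[X] - 'E_P[Y]| <= \int[P]_w (D w)%:E)%E.
Proof.
move=> iX iY mD XYD; rewrite unlock.
have iXY := integrableB measurableT iX iY.
have mXY := measurable_int _ iXY.
rewrite -(integralB measurableT iX iY).
apply: le_trans (le_abse_integral P measurableT mXY) _.
apply: ge0_le_integral => //.
- exact: measurableT_comp.
- exact/measurable_EFinP.
- by move=> w _; rewrite -EFinB /= lee_fin.
Qed.

Section contraction_bound.
Context d (T : measurableType d) (R : realType) (P : probability T R) (n : nat).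
Context (G : 4.-tuple 'I_n -> {RV P >-> R}).
Hypothesis GG : GOTE4 G.

Definition contract (u v : 'rV[R]_n) (w : T) : 'M[R]_n :=
  (Num.sqrt n%:R)^-1 *: tensor_contract (fun t => G t w) u v.

Lemma measurable_contract u v i j : measurable_fun setT (fun w => contract u v w i j).
Proof.
rewrite /contract; under eq_fun do rewrite !mxE.
apply: measurable_funM => //; apply: measurable_sum => k; apply: measurable_sum => l.
by do 2!apply: measurable_funM => //.
Qed.

Lemma contract_sym u v w : (contract u v w)^T = contract u v w.
Proof.
rewrite /contract linearZ /= tensor_contract_sym // => s t st.
by case: GG => sG _ _; exact: sG.
Qed.

Lemma contract_mgf_le u v x y (t : R) : (0 < n)%N -> dot x x <= 4 -> dot y y <= 4 ->
  dot u u = 1 ->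
  (\int[P]_w (expR (t * bform (contract u v w) x y))%:E
   <= (expR (32 * t ^+ 2 * norm2 v ^+ 2 / n%:R))%:E)%E.
Proof.
move=> n0 x4 y4 u1.
pose a s := t * (Num.sqrt n%:R)^-1 * rank1 x y u v s.
have aE w : t * bform (contract u v w) x y = \sum_s a s * G s w.
  rewrite bform_scalem bform_contract !mulr_sumr; apply: eq_bigr => s _.
  by rewrite /a; ring.
under eq_integral do rewrite aE.
apply: le_trans (GOTE4_mgf_le GG a) _; rewrite lee_fin ler_expR.
under eq_bigr do rewrite /a exprMn.
rewrite -mulr_sumr sum_rank1_sqr u1 mulr1 -(norm2_sqr v) exprMn exprVn sqr_sqrtr //.
have -> : 32 * t ^+ 2 * norm2 v ^+ 2 / n%:R
   = 2 * (t ^+ 2 / n%:R * (4 * 4 * norm2 v ^+ 2)) by ring.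
rewrite ler_pM2l // ler_wpM2l ?divr_ge0 ?sqr_ge0 //.
by rewrite ler_wpM2r ?sqr_ge0 // ler_pM // dotxx_ge0.
Qed.

(** For every real [z], [z <= 44 r + t^-1 * exp (t z - 44 n)] with [r = norm2 v]
    and [t = n / r].  Summing the exponential over all pairs of net points gives
    [D]; its expectation is at most [44 r + t^-1 * 4096 ^ n * exp (32 n - 44 n)],
    where [32 n] comes from [contract_mgf_le].  The constant [44] is chosen
    because [4096 = 2 ^ 12 <= exp 12], and [t^-1 <= r]. *)
Lemma contract_sup_bound u v : (0 < n)%N -> dot u u = 1 ->
  exists D : T -> R, [/\ measurable_fun setT D,
    (\int[P]_w (D w)%:E <= (45 * norm2 v)%:E)%E &
    forall w x y, dot x x <= 1 -> dot y y <= 1 -> bform (contract u v w) x y <= D w].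
Proof.
move=> n0 u1; set r := norm2 v.
have := norm2_ge0 v; rewrite -/r le_eqVlt => /predU1P[r0|r0].
  have v0 : v = 0 by apply: norm2_eq0.
  exists (cst 0); split=> //.
    by rewrite integral0 lee_fin -r0 mulr0.
  move=> w x y _ _; rewrite bform_scalem bform_contract big1 ?mulr0 // => t _.
  by rewrite /rank1 v0 mxE mulr0 mul0r.
have n1 : 0 < n%:R :> R by rewrite ltr0n.
pose t := n%:R / r.
have t0 : 0 < t by rewrite divr_gt0.
pose e (kl : grid n * grid n) w : R :=
  expR (t * bform (contract u v w) (gpoint R kl.1) (gpoint R kl.2)).
have e0 kl w : 0 <= e kl w by rewrite expR_ge0.
have me kl : measurable_fun setT (e kl).
  apply: measurableT_comp => //; apply: measurable_funM => //.
  by apply: measurable_bform => i j; exact: measurable_contract.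
pose N : {set grid n * grid n} := finset.setX (net R n) (net R n).
pose q := t^-1 * expR (- (44 * n%:R)).
have q0 : 0 <= q by rewrite mulr_ge0 ?expR_ge0 // invr_ge0 ltW.
exists (fun w => 44 * r + q * \sum_(kl in N) e kl w); split.
- apply: measurable_funD => //; apply: measurable_funM => //.
  under eq_fun do rewrite -big_filter.
  exact: measurable_sum.
- under eq_integral do rewrite EFinD (EFinM q) -sumEFin -big_filter.
  have mE kl : measurable_fun setT (fun w => (e kl w)%:E) by apply/measurable_EFinP.
  have mS : measurable_fun setT (fun w => \sum_(i <- [seq i <- index_enum _ | i \in N]) (e i w)%:E)%E.
    exact: emeasurable_sum.
  have S0 w : (0 <= \sum_(i <- [seq i <- index_enum _ | i \in N]) (e i w)%:E)%E.
    by apply: sume_ge0 => i _; rewrite lee_fin.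
  rewrite ge0_integralD //; first last.
  + exact: measurable_funeM.
  + by move=> w _; rewrite mule_ge0 ?lee_fin.
  + by move=> w _; rewrite lee_fin mulr_ge0 // ltW.
  have -> : (\int[P]__ (44 * r)%:E = (44 * r)%:E)%E.
    by rewrite integral_cst // [X in (_ * X)%E]probability_setT mule1.
  rewrite ge0_integralZl_EFin //.
  rewrite ge0_integral_sum //; last by move=> kl w _; rewrite lee_fin.
  rewrite big_filter.
  have Eb : (\sum_(kl in N) \int[P]_w (e kl w)%:E
      <= \sum_(kl in N) (expR (32 * n%:R))%:E)%E.
    apply: lee_sum => -[k l]; rewrite inE /= => /andP[kN lN].
    apply: le_trans (contract_mgf_le v t n0 (gpoint_le4 kN) (gpoint_le4 lN) u1) _.
    rewrite lee_fin ler_expR -/r /t le_eqVlt; apply/orP; left; apply/eqP.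
    by field; rewrite gt_eqF ?gt_eqF.
  apply: le_trans (_ : _ <= (44 * r)%:E + q%:E * \sum_(kl in N) (expR (32 * n%:R))%:E)%E _.
    by rewrite leeD2l // lee_wpmul2l.
  rewrite sumEFin -EFinM -EFinD lee_fin.
  have -> : 45 * r = 44 * r + r by ring.
  rewrite lerD2l sumr_const -[X in q * X]mulr_natl cardsX natrM.
  have [c [c0 cN ce]] : exists c : R, [/\ 0 <= c,
      #|net R n|%:R * #|net R n|%:R <= c ^+ n & c * expR (- 12) <= 1].
    exists (2 ^+ 12); split; first by rewrite exprn_ge0.
      have -> : 2 ^+ 12 = 64 * 64 :> R by ring.
      by rewrite exprMn ler_pM // card_net.
    rewrite expRN ler_pdivrMr ?expR_gt0 // mul1r.
    rewrite -[12 in leRHS]mulr1 expRM_natl lerXn2r ?nnegrE ?expR_ge0 //.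
    by have := expR_ge1Dx (1 : R).
  have tr : t^-1 <= r.
    rewrite /t invf_div ler_pdivrMr // -[leLHS]mulr1 ler_wpM2l ?(ltW r0) //.
    by rewrite ler1n.
  have qE : q * expR (32 * n%:R) = t^-1 * expR (- 12) ^+ n.
    rewrite /q -mulrA -expRD -expRM_natl; congr (_ * expR _); ring.
  rewrite mulrCA qE mulrCA -[leRHS]mulr1 ler_pM ?invr_ge0 ?(ltW t0) //.
  apply: le_trans (_ : _ <= c ^+ n * expR (- 12) ^+ n) _.
    by rewrite ler_wpM2r // exprn_ge0 ?expR_ge0.
  by rewrite -exprMn exprn_ile1 // mulr_ge0 ?expR_ge0.
move=> w x y x1 y1.
have [k [l [kN lN /le_trans]]] := net_dominates_bform (contract u v w) x1 y1.
apply; rewrite [in leRHS](bigD1 (k, l)) /=; last by rewrite inE kN.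
set Z := bform _ _ _.
apply: le_trans (_ : _ <= 44 * r + q * e (k, l) w) _; last first.
  by rewrite lerD2l ler_wpM2l // lerDl sumr_ge0.
have -> : q * e (k, l) w = t^-1 * expR (t * Z - 44 * n%:R).
  by rewrite /q /e /= -/Z -mulrA -expRD addrC.
have := expR_ge1Dx (t * Z - 44 * n%:R).
have -> : 44 * r = t^-1 * (44 * n%:R) by rewrite /t; field; rewrite !gt_eqF.
rewrite -mulrDr ler_pdivlMl //; lra.
Qed.

Lemma lambda1_contract_sub_le u v v' : (0 < n)%N -> dot u u = 1 ->
  exists D : T -> R, [/\ measurable_fun setT D,
    (\int[P]_w (D w)%:E <= (45 * norm2 (v - v'))%:E)%E &
    forall w, `|lambda1 (contract u v w) - lambda1 (contract u v' w)| <= D w].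
Proof.
move=> n0 u1; have [D [mD ED HD]] := contract_sup_bound (v - v') n0 u1.
exists D; split=> // w.
have cB : contract u v w - contract u v' w = contract u (v - v') w.
  by rewrite /contract tensor_contractBr scalerBr.
have := contract_sym u v w; have := contract_sym u v' w.
move=> s' s; rewrite ler_norml; apply/andP; split.
  rewrite lerNl opprB; apply: lambda1_sub_le => // x x1.
  (* The sign is absorbed by replacing one of the two arguments by its opposite. *)
  have -> : bform (contract u v' w - contract u v w) x x
      = bform (contract u (v - v') w) x (- x).
    by rewrite -cB -[- x]scaleN1r bformZr !bform_subm; ring.
  by apply: HD; rewrite ?x1 // -[- x]scaleN1r /dot bformZl bformZr -/(dot x x) x1; lra.
apply: lambda1_sub_le => // x x1; rewrite cB.
by apply: HD; rewrite x1.
Qed.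

Lemma measurable_lambda1_contract u v : (0 < n)%N ->
  measurable_fun setT (fun w => lambda1 (contract u v w)).
Proof.
move=> n0; apply: measurable_lambda1 => // [w|i j]; first exact: contract_sym.
exact: measurable_contract.
Qed.

(** Comparison with the contraction against [0], whose largest eigenvalue is
    [0]. *)
Lemma integrable_lambda1_contract u v : (0 < n)%N -> dot u u = 1 ->
  P.-integrable setT (fun w => (lambda1 (contract u v w))%:E).
Proof.
move=> n0 u1; have [D [mD ED HD]] := lambda1_contract_sub_le v 0 n0 u1.
have l0 w : lambda1 (contract u 0 w) = 0.
  have c0 : contract u 0 w = 0.
    by rewrite -(subrr u) /contract tensor_contractBr subrr scaler0.
  have [/eigenvalue_rayleigh[x _ <-] _] := lambda1_max n0 (contract_sym u 0 w).
  by rewrite c0 /bform mulmx0 mul0mx mxE.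
apply/integrableP; split.
  by apply/measurable_EFinP; exact: measurable_lambda1_contract.
apply: le_lt_trans (_ : (45 * norm2 (v - 0))%:E < +oo)%E; last exact: ltry.
apply: le_trans ED; apply: ge0_le_integral => //.
- by apply: measurableT_comp => //; apply/measurable_EFinP; exact: measurable_lambda1_contract.
- exact/measurable_EFinP.
- by move=> w _; have := HD w; rewrite l0 subr0 lee_fin.
Qed.

Lemma expectation_lambda1_sub_le u v v' : (0 < n)%N -> dot u u = 1 ->
  (`|'E_P[fun w => lambda1 (contract u v w)] - 'E_P[fun w => lambda1 (contract u v' w)]|
   <= (45 * norm2 (v - v'))%:E)%E.
Proof.
move=> n0 u1; have [D [mD ED HD]] := lambda1_contract_sub_le v v' n0 u1.
apply: le_trans ED; apply: expectation_sub_le => //.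
- exact: integrable_lambda1_contract.
- exact: integrable_lambda1_contract.
Qed.

End contraction_bound.

Lemma norm2_sub_unit_le2 (R : realType) n (u v : 'rV[R]_n) :
  norm2 u = 1 -> norm2 v = 1 -> norm2 (u - v) <= 2.
Proof.
move=> u1 v1; rewrite -(@ler_pXn2r _ 2) ?nnegrE ?norm2_ge0 // norm2_sqr.
rewrite dotxx.
have -> : 2 ^+ 2 = \sum_i (2 * u 0 i ^+ 2 + 2 * v 0 i ^+ 2).
  by rewrite big_split /= -!mulr_sumr -!dotxx -!norm2_sqr u1 v1; ring.
apply: ler_sum => i _; rewrite !mxE.
by have := sqr_ge0 (u 0 i + v 0 i); nra.
Qed.

(** For [eps >= 1/2] the first term is at least [90 >= 45 * r].  Otherwise
    [ln (1 / eps) >= 1/2], and [sqrt (r / 2) >= r / 2] because [r <= 2]. *)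
Lemma le_eps_sqrt_log (R : realType) (r eps : R) : 0 <= r <= 2 -> 0 < eps < 1 ->
  45 * r <= 180 * eps + 90 * Num.sqrt (r * ln (1 / eps)).
Proof.
move=> /andP[r0 r2] /andP[e0 e1].
have [e2|e2] := leP 2^-1 eps.
  by have := sqrtr_ge0 (r * ln (1 / eps)); lra.
have l2 : 2^-1 <= ln (1 / eps).
  rewrite div1r lnV ?posrE // lerNr.
  apply: le_trans (_ : ln (1 + - 2^-1) <= _).
    rewrite ler_ln ?posrE //; lra.
  by apply: le_ln1Dx; lra.
have : r / 2 <= Num.sqrt (r * ln (1 / eps)); last by lra.
have -> : r / 2 = Num.sqrt ((r / 2) ^+ 2) by rewrite sqrtr_sqr ger0_norm // divr_ge0.
by apply: ler_wsqrtr; have := ler_wpM2l r0 l2; nra.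
Qed.

Theorem theorem2p6 (R : realType) :
  exists C1 C2 : R, [/\ 0 < C1, 0 < C2 &
    forall (n : nat), (1 <= n)%N ->
    forall u v : 'rV[R]_n, unit_sphere R n u -> unit_sphere R n v ->
    forall (d : measure_display) (T : measurableType d) (P : probability T R)
      (G : 4.-tuple 'I_n -> {RV P >-> R}), GOTE4 G ->
    forall eps : R, 0 < eps < 1 ->
    (`| 'E_P[fun w => lambda1
                ((Num.sqrt n%:R)^-1 *: tensor_contract (fun i => G i w) u v)%R]
      - 'E_P[fun w => lambda1
                ((Num.sqrt n%:R)^-1 *: tensor_contract (fun i => G i w) u u)%R] |
     <= (C1 * eps + C2 * Num.sqrt (norm2 (u - v) * ln (1 / eps)))%:E)%E].
Proof.
exists 180, 90; split; [by rewrite ltr0n | by rewrite ltr0n |].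
move=> n n0 u v u1 v1 d T P G GG eps eps01.
have uu : dot u u = 1 by rewrite -norm2_sqr u1 expr1n.
apply: le_trans (expectation_lambda1_sub_le GG v u n0 uu) _; rewrite lee_fin.
have -> : norm2 (v - u) = norm2 (u - v).
  by rewrite /norm2; congr Num.sqrt; apply: eq_bigr => i _; rewrite !mxE -sqrrN opprB.
by apply: le_eps_sqrt_log => //; rewrite norm2_ge0 norm2_sub_unit_le2.
Qed.
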